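(* Let $R$ be a unital ring and let $\dim(\cdot|\cdot)$ be a bivariant Sylvester module rank function for $R$. For any left $R$-modules $\mathcal{M}_1\subseteq\mathcal{M}_2\subseteq\mathcal{M}_3$, $$\dim(\mathcal{M}_2|\mathcal{M}_3)=\dim(\mathcal{M}_1|\mathcal{M}_3)+\dim(\mathcal{M}_2/\mathcal{M}_1|\mathcal{M}_3/\mathcal{M}_1).$$
   Context: All modules are left modules. A bivariant Sylvester module rank function for $R$ is an $\mathbb{R}_{\ge 0}\cup\{+\infty\}$-valued function $(\mathcal{M}_1,\mathcal{M}_2)\mapsto\dim(\mathcal{M}_1|\mathcal{M}_2)$ on the class of all pairs of $R$-modules $\mathcal{M}_1\subseteq\mathcal{M}_2$ ($\mathcal{M}_1$ a submodule of $\mathcal{M}_2$) such that: (1) $\dim(\mathcal{M}_1|\mathcal{M}_2)$ is an isomorphism invariant of the pair; (2) writing $\dim(\mathcal{M}):=\dim(\mathcal{M}|\mathcal{M})$, one has $\dim(0)=0$ and $\dim(R)=1$; (3) $\dim(\mathcal{M}_1\oplus\mathcal{M}_3|\mathcal{M}_2\oplus\mathcal{M}_4)=\dim(\mathcal{M}_1|\mathcal{M}_2)+\dim(\mathcal{M}_3|\mathcal{M}_4)$ for all $\mathcal{M}_1\subseteq\mathcal{M}_2$, $\mathcal{M}_3\subseteq\mathcal{M}_4$; (4) $\dim(\mathcal{M}_1|\mathcal{M}_2)=\sup_{\mathcal{M}_1'}\dim(\mathcal{M}_1'|\mathcal{M}_2)$, with $\mathcal{M}_1'$ ranging over all finitely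 generated submodules of $\mathcal{M}_1$; (5) if $\mathcal{M}_1$ is finitely generated, $\dim(\mathcal{M}_1|\mathcal{M}_2)=\inf_{\mathcal{M}_2'}\dim(\mathcal{M}_1|\mathcal{M}_2')$, with $\mathcal{M}_2'$ ranging over all finitely generated submodules of $\mathcal{M}_2$ containing $\mathcal{M}_1$; (6) $\dim(\mathcal{M}_2)=\dim(\mathcal{M}_1|\mathcal{M}_2)+\dim(\mathcal{M}_2/\mathcal{M}_1)$ for all $\mathcal{M}_1\subseteq\mathcal{M}_2$. *)

(* Defs.v *)
From HB Require Import structures.
From mathcomp Require Import all_boot all_order all_algebra.
From mathcomp Require Import generic_quotient ring_quotient.
From mathcomp Require Import boolp classical_sets reals ereal.

Set Implicit Arguments.
Unset Strict Implicit.
Unset Printing Implicit Defensive.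

Import GRing.Theory.

Local Open Scope ring_scope.
Local Open Scope quotient_scope.

(* Submodules of [M : lmodType R] are the elements of [submodClosed M].  They
   are boolean predicates; since [boolp] makes every proposition decidable,
   every submodule in the usual sense is of this form. *)

Section Constructions.
Context {R : pzRingType}.
Implicit Types M N : lmodType R.

Definition full_pred M : {pred M} := fun=> true.

Fact full_pred_closed M : subsemimod_closed (@full_pred M).
Proof. by []. Qed.

HB.instance Definition _ M :=
  GRing.isSubmodClosed.Build R M (@full_pred M) (full_pred_closed M).

Definition full M : submodClosed M := @full_pred M.

Definition dsum_pred M N (A : submodClosed M) (B : submodClosed N) :
  {pred (M * N)%type} := fun z => (z.1 \in A) && (z.2 \in B).

Fact dsum_pred_closed M N (A : submodClosed M) (B : submodClosed N) :
  subsemimod_closed (dsum_pred A B).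
Proof.
split; first split.
- by rewrite unfold_in !rpred0.
- move=> x y /andP[x1 x2] /andP[y1 y2].
  by rewrite unfold_in /= !rpredD.
- by move=> a x /andP[x1 x2]; rewrite unfold_in /= !rpredZ.
Qed.

HB.instance Definition _ M N (A : submodClosed M) (B : submodClosed N) :=
  GRing.isSubmodClosed.Build R (M * N)%type (dsum_pred A B)
    (dsum_pred_closed A B).

Definition dsum M N (A : submodClosed M) (B : submodClosed N) :
  submodClosed (M * N)%type := dsum_pred A B.

Definition submod_preim_pred M N (f : {linear M -> N}) (B : submodClosed N) :
  {pred M} := fun x => f x \in B.

Fact submod_preim_pred_closed M N (f : {linear M -> N}) (B : submodClosed N) :
  subsemimod_closed (submod_preim_pred f B).
Proof.
split; first split.
- by rewrite unfold_in raddf0 rpred0.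
- by move=> x y fx fy; rewrite unfold_in raddfD rpredD.
- by move=> a x fx; rewrite unfold_in linearZ rpredZ.
Qed.

HB.instance Definition _ M N (f : {linear M -> N}) (B : submodClosed N) :=
  GRing.isSubmodClosed.Build R M (submod_preim_pred f B) (submod_preim_pred_closed f B).

Definition submod_preim M N (f : {linear M -> N}) (B : submodClosed N) :
  submodClosed M := submod_preim_pred f B.

Definition submod_im_pred M N (f : {linear M -> N}) (A : submodClosed M) :
  {pred N} := fun y => `[< exists2 x, x \in A & f x = y >].

Fact submod_im_pred_closed M N (f : {linear M -> N}) (A : submodClosed M) :
  subsemimod_closed (submod_im_pred f A).
Proof.
split; first split.
- by apply/asboolP; exists 0; rewrite ?rpred0 ?raddf0.
- move=> _ _ /asboolP[x xA <-] /asboolP[y yA <-].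
  by apply/asboolP; exists (x + y); rewrite ?rpredD ?raddfD.
- move=> a _ /asboolP[x xA <-].
  by apply/asboolP; exists (a *: x); rewrite ?rpredZ ?linearZ.
Qed.

HB.instance Definition _ M N (f : {linear M -> N}) (A : submodClosed M) :=
  GRing.isSubmodClosed.Build R N (submod_im_pred f A) (submod_im_pred_closed f A).

Definition submod_im M N (f : {linear M -> N}) (A : submodClosed M) :
  submodClosed N := submod_im_pred f A.

Definition fin_gen M (A : submodClosed M) : Prop :=
  exists s : seq M, forall x : M,
    x \in A <-> exists c : 'I_(size s) -> R, x = \sum_i c i *: s`_i.

Definition submod_type M (A : submodClosed M) : Type := {x : M | x \in A}.

HB.instance Definition _ M (A : submodClosed M) :=
  SubChoice.on (submod_type A).
HB.instance Definition _ M (A : submodClosed M) :=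
  [SubChoice_isSubLmodule of submod_type A by <:].

Definition incl M (A : submodClosed M) : {linear submod_type A -> M} :=
  (val : submod_type A -> M).

(* The library only builds [{quot _}] from a [zmodClosed] predicate, which a
   [submodClosed] one is not syntactically. *)
Definition zmod_pred M (A : submodClosed M) : {pred M} := fun x => x \in A.

Fact zmod_pred_closed M (A : submodClosed M) : zmod_closed (zmod_pred A).
Proof.
split=> [|x y xA yA]; rewrite unfold_in ?rpred0 //.
by rewrite -scaleN1r rpredD // rpredZ.
Qed.

HB.instance Definition _ M (A : submodClosed M) :=
  GRing.isZmodClosed.Build M (zmod_pred A) (zmod_pred_closed A).

Definition quot M (A : submodClosed M) : Type := Quotient.quot (zmod_pred A).

HB.instance Definition _ M (A : submodClosed M) :=
  GRing.Zmodule.on (quot A).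

Definition proj M (A : submodClosed M) (x : M) : quot A :=
  \pi_(Quotient.quot (zmod_pred A)) x.

Definition quot_scale M (A : submodClosed M) (a : R) (u : quot A) : quot A :=
  proj A (a *: repr (u : Quotient.quot (zmod_pred A))).

Lemma proj_eq M (A : submodClosed M) (x y : M) :
  (proj A x == proj A y) = (x - y \in A).
Proof. by rewrite /proj -Quotient.idealrBE. Qed.

Lemma proj_surj M (A : submodClosed M) (u : quot A) : exists x, proj A x = u.
Proof. by exists (repr (u : Quotient.quot (zmod_pred A))); exact: reprK. Qed.

Lemma projD M (A : submodClosed M) (x y : M) :
  proj A (x + y) = proj A x + proj A y.
Proof. exact: (raddfD (\pi_(Quotient.quot (zmod_pred A)))). Qed.

Lemma projZ M (A : submodClosed M) (a : R) (x : M) :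
  proj A (a *: x) = quot_scale a (proj A x).
Proof.
apply/eqP; rewrite /quot_scale proj_eq -scalerBr rpredZ // -proj_eq.
by rewrite /proj reprK.
Qed.

Section QuotLmodule.
Variables (M : lmodType R) (A : submodClosed M).

Fact quot_scaleA (a b : R) (u : quot A) :
  quot_scale a (quot_scale b u) = quot_scale (a * b) u.
Proof. by have [x <-] := proj_surj u; rewrite -!projZ scalerA. Qed.

Fact quot_scale1 : left_id 1 (@quot_scale M A).
Proof. by move=> u; have [x <-] := proj_surj u; rewrite -projZ scale1r. Qed.

Fact quot_scaleDr : right_distributive (@quot_scale M A) +%R.
Proof.
move=> a u v; have [x <-] := proj_surj u; have [y <-] := proj_surj v.
by rewrite -projD -!projZ scalerDr projD.
Qed.

Fact quot_scaleDl (u : quot A) :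
  {morph (@quot_scale M A)^~ u : a b / a + b}.
Proof.
by move=> a b; have [x <-] := proj_surj u; rewrite -!projZ scalerDl projD.
Qed.

HB.instance Definition _ := GRing.Zmodule_isLmodule.Build R (quot A)
  quot_scaleA quot_scale1 quot_scaleDr quot_scaleDl.

Fact proj_is_linear : linear (proj A).
Proof. by move=> a x y; rewrite projD projZ. Qed.

HB.instance Definition _ :=
  GRing.isLinear.Build R M (quot A) *:%R (proj A) proj_is_linear.

End QuotLmodule.

(* [B / A] as a submodule of [M / A]; meant for [A] contained in [B]. *)
Definition quot_submod M (A B : submodClosed M) : submodClosed (quot A) :=
  submod_im (proj A) B.

(* [B] as a submodule of [A]; meant for [B] contained in [A]. *)
Definition restr_submod M (A B : submodClosed M) :
  submodClosed (submod_type A) := submod_preim (incl A) B.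

Definition pair_iso M N (A : submodClosed M) (B : submodClosed N) : Prop :=
  exists f : {linear M -> N},
    bijective f /\ forall x : M, (f x \in B) = (x \in A).

End Constructions.

Local Open Scope classical_set_scope.
Local Open Scope ereal_scope.

(* The value [rk A], for [A : submodClosed M], is dim(A | M). *)
Record bivariant_rank (R : pzRingType) (K : realType) := BivariantRank {
  rk :> forall M : lmodType R, submodClosed M -> \bar K;
  rk_ge0 : forall (M : lmodType R) (A : submodClosed M), 0 <= rk A;
  rk_iso : forall (M N : lmodType R) (A : submodClosed M) (B : submodClosed N),
    pair_iso A B -> rk A = rk B;
  rk_zero : forall M : lmodType R, (forall x : M, x = 0%R) -> rk (full M) = 0;
  rk_ring : rk (full R^o) = 1;
  rk_dsum : forall (M N : lmodType R) (A : submodClosed M) (B : submodClosed N),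
    rk (dsum A B) = rk A + rk B;
  rk_sup : forall (M : lmodType R) (A : submodClosed M),
    rk A = ereal_sup
      [set rk A' | A' in [set A' : submodClosed M |
                           fin_gen A' /\ {subset A' <= A}]];
  rk_inf : forall (M : lmodType R) (A : submodClosed M), fin_gen A ->
    rk A = ereal_inf
      [set rk (restr_submod B A) | B in [set B : submodClosed M |
                                          fin_gen B /\ {subset A <= B}]];
  rk_quot : forall (M : lmodType R) (A : submodClosed M),
    rk (full M) = rk A + rk (full (quot A))
}.

(* Main.v *)
(* For a linear map f : M -> N one shows dim(f A | N) <= dim(A | M); when M is
   finitely generated and f is onto this is right exactness of
   M -> N (+) M/A -> N/f(A) -> 0, and the sup and inf axioms reduce the general
   case to it.  When M3 is finitely generated all ranks are finite, and the
   formula is obtained by cancellation from the quotient axiom.  In general, with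
   h : M3 -> M3/M1, it suffices to prove, for F in M2 and G in M1 finitely
   generated,
     dim(G | M3) + dim(h F | M3/M1) <= dim(G + F | M3)  and
     dim(F | M3) <= dim(M1 | M3) + dim(h F | M3/M1).
   Both follow by computing inside finitely generated submodules of M3: for the
   second, dim(F | M3) <= dim(G | M3) + dim((F + G)/G | B/G) holds for every
   finitely generated B containing F and every finitely generated G in
   B :&: M1. *)

Require Import Defs.
From mathcomp Require Import all_boot all_order all_algebra.
From mathcomp Require Import reals ereal.
From HB Require Import structures.
From mathcomp Require Import boolp classical_sets constructive_ereal.

Set Implicit Arguments.
Unset Strict Implicit.
Unset Printing Implicit Defensive.

Import Order.TTheory GRing.Theory Num.Theory.

Local Open Scope ring_scope.

(** * Images, kernels and restrictions of submodules *)

Section Submodules.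
Context {R : pzRingType}.
Implicit Types M N P : lmodType R.

Lemma mem_submod_im M N (f : {linear M -> N}) (A : submodClosed M) (y : N) :
  y \in submod_im f A <-> exists2 x, x \in A & f x = y.
Proof. by split=> /asboolP. Qed.

Lemma mem_submod_im_apply M N (f : {linear M -> N}) (A : submodClosed M) x :
  x \in A -> f x \in submod_im f A.
Proof. by move=> xA; apply/mem_submod_im; exists x. Qed.

Lemma in_dsum M N (A : submodClosed M) (B : submodClosed N) z :
  (z \in dsum A B) = (z.1 \in A) && (z.2 \in B).
Proof. by []. Qed.

Lemma in_restr M (B A : submodClosed M) (x : submod_type B) :
  (x \in restr_submod B A) = (val x \in A).
Proof. by []. Qed.

Lemma in_preim M N (f : {linear M -> N}) (B : submodClosed N) x :
  (x \in submod_preim f B) = (f x \in B).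
Proof. by []. Qed.

Lemma submod_imS M N (f : {linear M -> N}) (A B : submodClosed M) :
  {subset A <= B} -> {subset submod_im f A <= submod_im f B}.
Proof.
by move=> AB y /mem_submod_im[x /AB xB <-]; apply: mem_submod_im_apply.
Qed.

(** Encoded as the image of the zero map, so that closure comes from [submod_im]. *)
Definition zero_submod M : submodClosed M := submod_im (\0 : {linear M -> M}) (full M).

Lemma in_zero M (x : M) : (x \in zero_submod M) = (x == 0).
Proof.
apply/idP/eqP => [/mem_submod_im[y _ <-]//|->].
by apply/mem_submod_im; exists 0.
Qed.

Definition submod_ker M N (f : {linear M -> N}) : submodClosed M :=
  submod_preim f (zero_submod N).

Lemma in_submod_ker M N (f : {linear M -> N}) x : (x \in submod_ker f) = (f x == 0).
Proof. by rewrite in_preim in_zero. Qed.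

(** * Linear maps obtained from universal properties *)

Lemma cosum_linear M N P (f : {linear M -> P}) (g : {linear N -> P}) :
  linear (fun z : M * N => f z.1 + g z.2).
Proof. by move=> a x y /=; rewrite !linearP scalerDr addrACA. Qed.

Lemma cosum_ex M N P (f : {linear M -> P}) (g : {linear N -> P}) :
  exists h : {linear (M * N)%type -> P}, forall x y, h (x, y) = f x + g y.
Proof.
pose h := GRing.isLinear.Build R _ _ _ _ (cosum_linear f g).
pose H : {linear (M * N)%type -> P} :=
  HB.pack (fun z : M * N => f z.1 + g z.2) h.
by exists H.
Qed.

Lemma pair_linear_ex M N P (f : {linear P -> M}) (g : {linear P -> N}) :
  exists h : {linear P -> (M * N)%type}, forall x, h x = (f x, g x).
Proof.
have hl : linear (fun x => (f x, g x) : (M * N)%type).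
  by move=> a x y /=; rewrite !linearP.
pose H : {linear P -> (M * N)%type} := HB.pack (fun x => (f x, g x) : (M * N)%type)
  (GRing.isLinear.Build R _ _ _ _ hl).
by exists H.
Qed.

Lemma smul_ex M (x : M) : exists h : {linear R^o -> M}, forall a : R, h a = a *: x.
Proof.
have hl : linear (fun a : R^o => (a : R) *: x).
  by move=> a b c /=; rewrite scalerDl scalerA.
pose H : {linear R^o -> M} := HB.pack (fun a : R^o => (a : R) *: x)
  (GRing.isLinear.Build R _ _ _ _ hl).
by exists H.
Qed.

Lemma corestr_ex M N (f : {linear M -> N}) (B : submodClosed N) :
  (forall x, f x \in B) ->
  exists g : {linear M -> submod_type B}, forall x, val (g x) = f x.
Proof.
move=> fB.
pose g x : submod_type B := exist _ (f x) (fB x).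
have gl : linear g by move=> a x y; apply: val_inj; rewrite /= linearP.
pose H : {linear M -> submod_type B} := HB.pack g (GRing.isLinear.Build R _ _ _ _ gl).
by exists H.
Qed.

Lemma corestr_im_ex M N (f : {linear M -> N}) :
  exists g : {linear M -> submod_type (submod_im f (full M))},
    (forall y, exists x, g x = y) /\ forall x, val (g x) = f x.
Proof.
have [x|g gE] := @corestr_ex M N f (submod_im f (full M)).
  exact: mem_submod_im_apply.
exists g; split=> // y; have /mem_submod_im[x _ fx] := valP y.
by exists x; apply: val_inj; rewrite gE.
Qed.

Lemma quot_lift_ex M N (f : {linear M -> N}) (A : submodClosed M) :
  {subset A <= submod_ker f} ->
  exists g : {linear quot A -> N}, forall x, g (proj A x) = f x.
Proof.
move=> Af.
(* A representative of [u] is chosen; [gE] shows that the value does not depend on it. *)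
pose g (u : quot A) := f (projT1 (cid (proj_surj u))).
have gE x : g (proj A x) = f x.
  rewrite /g; case: cid => y /= /eqP; rewrite proj_eq => /Af.
  by rewrite in_submod_ker raddfB subr_eq0 => /eqP.
have gl : linear g.
  move=> a u v; have [x <-] := proj_surj u; have [y <-] := proj_surj v.
  by rewrite -linearP !gE linearP.
pose H : {linear quot A -> N} := HB.pack g (GRing.isLinear.Build R _ _ _ _ gl).
by exists H.
Qed.

(** * Sums, spans and finite generation *)

Definition submod_add M (A B : submodClosed M) : submodClosed M :=
  submod_im (projT1 (cid (cosum_ex (idfun : {linear M -> M}) idfun))) (dsum A B).

Lemma in_add M (A B : submodClosed M) x :
  x \in submod_add A B <-> exists y z, [/\ y \in A, z \in B & x = y + z].
Proof.
rewrite /submod_add; case: cid => h /= hE; split.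
  move=> /mem_submod_im[[y z]]; rewrite in_dsum /= => /andP[yA zB] <-.
  by exists y, z; split=> //; rewrite hE.
move=> [y [z [yA zB ->]]]; apply/mem_submod_im; exists (y, z); last by rewrite hE.
by rewrite in_dsum /= yA.
Qed.

Lemma submod_addl M (A B : submodClosed M) : {subset A <= submod_add A B}.
Proof. by move=> x xA; apply/(in_add A B); exists x, 0; rewrite rpred0 addr0. Qed.

Lemma submod_addr M (A B : submodClosed M) : {subset B <= submod_add A B}.
Proof. by move=> x xA; apply/(in_add A B); exists 0, x; rewrite rpred0 add0r. Qed.

Lemma submod_add_sub M (A B C : submodClosed M) :
  {subset A <= C} -> {subset B <= C} -> {subset submod_add A B <= C}.
Proof. by move=> AC BC x /in_add[y [z [/AC yC /BC zC ->]]]; rewrite rpredD. Qed.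

(** Recursion on the list suits inductions on generators; [in_spanP] recovers the linear
    combinations of [fin_gen]. *)
Fixpoint span M (s : seq M) : submodClosed M :=
  if s is x :: s' then
    submod_add (submod_im (projT1 (cid (smul_ex x))) (full R^o)) (span s')
  else zero_submod M.

Lemma in_span_cons M x (s : seq M) y :
  y \in span (x :: s) <-> exists a z, z \in span s /\ y = a *: x + z.
Proof.
pose h := projT1 (cid (smul_ex x)).
have hE : forall a : R, h a = a *: x := projT2 (cid (smul_ex x)).
rewrite -[span _]/(submod_add (submod_im h (full R^o)) (span s)); split.
  move=> /in_add[u [z [/mem_submod_im[a _ <-] zs ->]]].
  by exists a, z; rewrite hE.
move=> [a [z [zs ->]]]; apply/in_add; exists (a *: x), z; split=> //.
by rewrite -hE; apply: mem_submod_im_apply.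
Qed.

Lemma in_spanP M (s : seq M) x :
  x \in span s <-> exists c : 'I_(size s) -> R, x = \sum_i c i *: s`_i.
Proof.
elim: s x => [|y s IH] x.
  rewrite in_zero; split=> [/eqP->|[c ->]]; last by rewrite big_ord0.
  by exists (fun=> 0); rewrite big_ord0.
rewrite in_span_cons; split.
  move=> [a [z [/IH[c ->] ->]]].
  exists (fun i => oapp c a (unlift ord0 i)).
  rewrite big_ord_recl unlift_none; congr (_ + _).
  by apply: eq_bigr => i _; rewrite liftK.
move=> [c ->]; rewrite big_ord_recl.
exists (c ord0), (\sum_(i < size s) c (lift ord0 i) *: s`_i); split=> //.
by apply/IH; exists (c \o lift ord0).
Qed.

Lemma fin_gen_span M (s : seq M) : fin_gen (span s).
Proof. by exists s => x; apply: in_spanP. Qed.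

Lemma fin_genP M (A : submodClosed M) : fin_gen A <-> exists s, A =i span s.
Proof.
split=> [] [s sA]; exists s => x.
  by apply/idP/idP => [/sA/in_spanP|/in_spanP/sA].
by rewrite sA; apply: in_spanP.
Qed.

Lemma span_sub M (s : seq M) (A : submodClosed M) :
  {subset span s <= A} <-> {subset s <= A}.
Proof.
elim: s => [|x s IH].
  by split=> // _ y; rewrite in_zero => /eqP->; rewrite rpred0.
split=> [sA y|sA y].
  rewrite inE => /predU1P[->|ys].
    by apply/sA/in_span_cons; exists 1, 0; rewrite rpred0 scale1r addr0.
  have /IH : {subset span s <= A} by move=> z zs; apply/sA/in_span_cons;
    exists 0, z; rewrite scale0r add0r.
  exact.
move=> /in_span_cons[a [z [zs ->]]].
have /IH/(_ _ zs) zA : {subset s <= A}.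
  by move=> t ts; apply: sA; rewrite inE ts orbT.
by rewrite rpredD // rpredZ // sA // mem_head.
Qed.

Lemma mem_span M (s : seq M) : {subset s <= span s}.
Proof. exact/span_sub. Qed.

Lemma span_map M N (f : {linear M -> N}) (s : seq M) :
  span (map f s) =i submod_im f (span s).
Proof.
move=> y; apply/idP/idP.
  apply: (iffRL (span_sub _ _)) => _ /mapP[x xs ->].
  by apply: mem_submod_im_apply; apply: mem_span.
have sub : {subset span s <= submod_preim f (span (map f s))}.
  by apply/span_sub => x xs; rewrite in_preim mem_span ?map_f.
by move=> /mem_submod_im[x /sub + <-].
Qed.

Lemma fin_gen_im M N (f : {linear M -> N}) (A : submodClosed M) :
  fin_gen A -> fin_gen (submod_im f A).
Proof.
move=> /fin_genP[s sA]; apply/fin_genP; exists (map f s) => y.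
rewrite span_map; apply/idP/idP; apply: submod_imS => x; by rewrite sA.
Qed.

Lemma fin_gen_add M (A B : submodClosed M) :
  fin_gen A -> fin_gen B -> fin_gen (submod_add A B).
Proof.
move=> /fin_genP[s sA] /fin_genP[t tB]; apply/fin_genP; exists (s ++ t) => x.
apply/idP/idP.
  apply: submod_add_sub => {}x; rewrite (sA, tB);
    by apply: (iffRL (span_sub _ _)) => {}x xs; apply: mem_span;
      rewrite mem_cat xs ?orbT.
apply: (iffRL (span_sub _ _)) => {}x; rewrite mem_cat => /orP[] /mem_span.
  by rewrite -sA; apply: submod_addl.
by rewrite -tB; apply: submod_addr.
Qed.

Lemma lift_seq M N (f : {linear M -> N}) (A : submodClosed M) (s : seq N) :
  {subset s <= submod_im f A} -> exists2 t, {subset t <= A} & map f t = s.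
Proof.
elim: s => [|y s IH] sA; first by exists [::].
have [|t tA <-] := IH; first by move=> z zs; apply: sA; rewrite inE zs orbT.
have /mem_submod_im[x xA <-] := sA y (mem_head _ _).
by exists (x :: t) => // z; rewrite inE => /predU1P[->|/tA].
Qed.

(** Each generator of [B] has a preimage in [A]; [A'] is the span of these preimages. *)
Lemma fin_gen_lift M N (f : {linear M -> N}) (A : submodClosed M)
    (B : submodClosed N) : fin_gen B -> {subset B <= submod_im f A} ->
  exists A', [/\ fin_gen A', {subset A' <= A} & submod_im f A' =i B].
Proof.
move=> /fin_genP[s sB] BA.
have [|t tA ts] := @lift_seq M N f A s.
  by move=> y /mem_span; rewrite -sB; apply: BA.
exists (span t); split; [exact: fin_gen_span|exact/span_sub|].
by move=> y; rewrite sB -span_map ts.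
Qed.

Lemma im_incl M (B : submodClosed M) (A : submodClosed M) :
  {subset A <= B} -> submod_im (incl B) (restr_submod B A) =i A.
Proof.
move=> AB x; apply/idP/idP => [/mem_submod_im[y + <-]//|xA].
by apply/mem_submod_im; exists (exist _ x (AB x xA)); rewrite ?in_restr.
Qed.

(** Generators of [A] lift along the inclusion of [B]; by injectivity the lifts span all of
    [restr_submod B A]. *)
Lemma fin_gen_restr M (B A : submodClosed M) :
  {subset A <= B} -> fin_gen A -> fin_gen (restr_submod B A).
Proof.
move=> AB Afg.
have [|A' [/fin_genP[s sA'] _ iA']] := @fin_gen_lift _ _ (incl B) (full _) A Afg.
  move=> x xA; apply/mem_submod_im; by exists (exist _ x (AB x xA)).
apply/fin_genP; exists s => x; rewrite -sA' in_restr -iA'.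
apply/idP/idP => [/mem_submod_im[y yA' /val_inj <-]//|].
exact: (mem_submod_im_apply (incl B)).
Qed.

Lemma eq_fin_gen M (A B : submodClosed M) : A =i B -> fin_gen A -> fin_gen B.
Proof.
by move=> AB /fin_genP[s sA]; apply/fin_genP; exists s => x; rewrite -AB.
Qed.

Lemma fin_gen_full_sub M (B : submodClosed M) :
  fin_gen B -> fin_gen (full (submod_type B)).
Proof.
move=> Bfg; apply: eq_fin_gen (fin_gen_restr (B := B) _ Bfg) => // x.
by rewrite in_restr; apply: (valP x).
Qed.

Lemma fin_gen_full_surj M N (f : {linear M -> N}) :
  (forall y, exists x, f x = y) -> fin_gen (full M) -> fin_gen (full N).
Proof.
move=> fs /(fin_gen_im f); apply: eq_fin_gen => y.
by have [x <-] := fs y; rewrite mem_submod_im_apply.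
Qed.

End Submodules.

Local Open Scope ereal_scope.

(** * Monotonicity, surjections and finiteness of the rank *)

Section Rank.
Context {R : pzRingType} {K : realType} (dim : bivariant_rank R K).
Implicit Types M N P : lmodType R.
Local Notation d := (@rk R K dim _).

Lemma rk_ext M (A B : submodClosed M) : A =i B -> d A = d B.
Proof.
move=> AB; apply: rk_iso; exists idfun; split; first by exists idfun.
by move=> x; rewrite AB.
Qed.

(** The sup axiom in a form usable inside sums: a finite [b] can be moved across the inequality. The
    next lemma does the same for the inf axiom. *)
Lemma rk_le_ub M (A : submodClosed M) (b c : \bar K) : b \is a fin_num ->
  (forall A' : submodClosed M, fin_gen A' -> {subset A' <= A} -> d A' + b <= c) ->
  d A + b <= c.
Proof.
move=> bfin H; rewrite -leeBrDr // rk_sup; apply: ge_ereal_sup.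
by move=> _ [A' [A'fg A'A] <-]; rewrite leeBrDr //; apply: H.
Qed.

Lemma rk_ge_lb M (A : submodClosed M) (b c : \bar K) : b \is a fin_num ->
  fin_gen A ->
  (forall B : submodClosed M, fin_gen B -> {subset A <= B} ->
     c <= d (restr_submod B A) + b) ->
  c <= d A + b.
Proof.
move=> bfin Afg H; rewrite -leeBlDr // rk_inf //; apply: le_ereal_inf_tmp.
by move=> _ [B [Bfg AB] <-]; rewrite leeBlDr //; apply: H.
Qed.

Lemma rkS M (A B : submodClosed M) : {subset A <= B} -> d A <= d B.
Proof.
move=> AB; rewrite [leLHS]rk_sup; apply: ge_ereal_sup => _ [A' [A'fg A'A] <-].
rewrite [leRHS]rk_sup; apply: ereal_sup_ubound; exists A' => //.
by split=> // x /A'A /AB.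
Qed.

Lemma rk_restr M (A B : submodClosed M) : fin_gen A -> fin_gen B ->
  {subset A <= B} -> d A <= d (restr_submod B A).
Proof.
by move=> Afg Bfg AB; rewrite [leLHS]rk_inf//; apply: ereal_inf_lbound; exists B.
Qed.

(** The map induced by [f] on M/ker f is an isomorphism onto N, so this is the quotient axiom for
    ker f. *)
Lemma rk_surj M N (f : {linear M -> N}) : (forall y, exists x, f x = y) ->
  d (full M) = d (submod_ker f) + d (full N).
Proof.
move=> fs; rewrite (rk_quot dim (submod_ker f)); congr (_ + _).
have [g gE] := @quot_lift_ex _ _ _ f (submod_ker f) (fun=> id).
apply: rk_iso; exists g; split=> //.
have ginj : injective g.
  move=> u v; have [x <-] := proj_surj u; have [y <-] := proj_surj v.
  rewrite !gE => /eqP; rewrite -subr_eq0 -raddfB -in_submod_ker -proj_eq.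
  by move/eqP.
exists (fun y => proj (submod_ker f) (projT1 (cid (fs y)))) => [u|y].
  by apply: ginj; rewrite gE; case: cid.
by rewrite gE; case: cid.
Qed.

Lemma rk_full_surj_le M N (f : {linear M -> N}) : (forall y, exists x, f x = y) ->
  d (full N) <= d (full M).
Proof. by move=> fs; rewrite (rk_surj fs) leeDr // rk_ge0. Qed.

(** [span (x :: s)] is a quotient of R (+) [span s], so each generator adds at most 1. *)
Lemma rk_full_span_lty M (s : seq M) : d (full (submod_type (span s))) < +oo.
Proof.
elim: s => [|x s IH].
  rewrite rk_zero ?ltry // => y; apply/val_inj/eqP.
  by rewrite -in_zero; apply: (valP y).
have [h hE] := smul_ex x.
have [k kE] := cosum_ex h (incl (span s)).
have [z|g gE] := @corestr_ex _ _ _ k (span (x :: s)).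
  case: z => a z; rewrite kE hE; apply/in_span_cons.
  by exists a, (val z); split=> //; apply: (valP z).
apply: (@le_lt_trans _ _ (d (full (R^o * submod_type (span s))%type))).
  apply: (rk_full_surj_le (f := g)) => y.
  have /in_span_cons[a [z [zs yE]]] := valP y.
  exists (a, exist _ z zs); apply: val_inj.
  by rewrite gE kE hE yE.
rewrite (@rk_ext _ _ (dsum (full R^o) (full (submod_type (span s))))) //.
by rewrite rk_dsum rk_ring lte_add_pinfty // ltry.
Qed.

Lemma rk_fin M (A : submodClosed M) : fin_gen (full M) -> d A \is a fin_num.
Proof.
move=> /fin_genP[s sM]; rewrite ge0_fin_numE ?rk_ge0 //.
apply: le_lt_trans (rkS (B := full M) _) _ => //.
apply: le_lt_trans (rk_full_span_lty s).
apply: (rk_full_surj_le (f := incl (span s))) => y.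
by have ys : y \in span s; [rewrite -sM | exists (exist _ y ys)].
Qed.

Lemma rk_quot_fin M (A : submodClosed M) (B : submodClosed (quot A)) :
  fin_gen (full M) -> d B \is a fin_num.
Proof.
move=> Mfg; apply: rk_fin; apply: (fin_gen_full_surj (f := proj A)) => //.
exact: proj_surj.
Qed.

(** Here M is arbitrary: shrinking the ambient module to [A] itself can only raise the rank, and
    there [rk_fin] applies. *)
Lemma rk_fin_gen_fin M (A : submodClosed M) : fin_gen A -> d A \is a fin_num.
Proof.
move=> Afg; rewrite ge0_fin_numE ?rk_ge0 //.
apply: le_lt_trans (rk_restr Afg Afg _) _ => //.
by rewrite -ge0_fin_numE ?rk_ge0 // rk_fin //; apply: fin_gen_full_sub.
Qed.

(** * Linear maps do not increase the rank of a submodule *)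

Lemma rk_im_full_le M N (f : {linear M -> N}) :
  fin_gen (full M) -> d (submod_im f (full M)) <= d (full M).
Proof.
move=> Mfg; have ffg := fin_gen_im f Mfg.
apply: le_trans (rk_restr ffg ffg _) _ => //.
rewrite (@rk_ext _ _ (full (submod_type (submod_im f (full M))))); last first.
  by move=> x; rewrite in_restr; apply: (valP x).
by have [g [gs _]] := corestr_im_ex f; apply: rk_full_surj_le gs.
Qed.

(* The sequence M -> N (+) M/A -> N/f(A) -> 0 with first map x |-> (f x, - x)
   is exact. *)
Lemma rk_im_surj_fin_gen M N (f : {linear M -> N}) (A : submodClosed M) :
  fin_gen (full M) -> (forall y, exists x, f x = y) ->
  d (submod_im f A) <= d A.
Proof.
move=> Mfg fs.
have [g gE] := pair_linear_ex f (\- (proj A) : {linear M -> quot A})%R.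
have [x xA|fbar fbarE] := @quot_lift_ex _ _ _ (proj (submod_im f A) \o f)%FUN A.
  by rewrite in_submod_ker -(raddf0 (proj _)) proj_eq subr0 mem_submod_im_apply.
have [h hE] := cosum_ex (proj (submod_im f A)) fbar.
have hker : submod_ker h =i submod_im g (full M).
  case=> y u; have [z <-] := proj_surj u; rewrite in_submod_ker hE fbarE /=.
  rewrite -raddfD -(raddf0 (proj (submod_im f A))) proj_eq subr0.
  apply/idP/idP => [/mem_submod_im[a aA fa]|/mem_submod_im[x _]].
    (* Here y + f z = f a with a in [A], so [g] sends a - z to (y, z - a), and a vanishes modulo
       [A]. *)
    apply/mem_submod_im; exists (a - z)%R => //; rewrite gE /=; congr (_, _).
      by rewrite linearB fa addrK.
    rewrite linearB opprB -[RHS]subr0; congr (_ - _)%R.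
    by apply/eqP; rewrite -(raddf0 (proj A)) proj_eq subr0.
  rewrite gE => -[<- /eqP]; rewrite /= -linearN proj_eq => xz.
  rewrite -linearD; apply: mem_submod_im_apply.
  by rewrite -[(x + z)%R]opprK opprD -scaleN1r rpredZ.
have hs v : exists w, h w = v.
  have [y <-] := proj_surj v.
  by exists (y, 0%R); rewrite hE linear0 addr0.
have := rk_surj hs; rewrite (rk_ext hker).
rewrite (@rk_ext _ (full _) (dsum (full N) (full (quot A)))) // rk_dsum.
have fQ := rk_quot_fin (full (quot A)) Mfg.
have fQ' := rk_quot_fin (full (quot (submod_im f A))) (fin_gen_full_surj fs Mfg).
rewrite (rk_quot dim (submod_im f A)) => E.
(* Adding the finite ranks of N/f(A) and M/A to both sides turns the goal into dim(g M) <= dim(M),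
   up to the common term dim(N/f(A)). *)
rewrite -(leeD2rE _ _ fQ') -(leeD2rE _ _ fQ) E addeAC -(rk_quot dim A).
by rewrite leeD2r // rk_im_full_le.
Qed.

(** Shrinking N to f(M) raises the rank of f(A) and makes the map onto. *)
Lemma rk_im_fin_gen M N (f : {linear M -> N}) (A : submodClosed M) :
  fin_gen (full M) -> fin_gen A -> d (submod_im f A) <= d A.
Proof.
move=> Mfg Afg; have [g [gs gE]] := corestr_im_ex f.
apply: le_trans (rk_restr (fin_gen_im f Afg) (fin_gen_im f Mfg) _) _.
  exact: submod_imS.
apply: le_trans (rk_im_surj_fin_gen A Mfg gs).
rewrite (@rk_ext _ _ (submod_im g A)) // => y; rewrite in_restr.
apply/idP/idP => /mem_submod_im[x xA yE]; apply/mem_submod_im; exists x => //.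
  by apply: val_inj; rewrite gE.
by rewrite -yE gE.
Qed.

Lemma rk_im_le M N (f : {linear M -> N}) (A : submodClosed M) :
  d (submod_im f A) <= d A.
Proof.
rewrite -[leLHS]adde0; apply: rk_le_ub => // B Bfg BA; rewrite adde0.
have [A' [A'fg A'A fA']] := fin_gen_lift Bfg BA.
rewrite -(rk_ext fA'); apply: le_trans (rkS A'A).
rewrite -[leRHS]adde0; apply: rk_ge_lb => // C Cfg A'C; rewrite adde0.
(* M is replaced by the finitely generated [C], and [f] by its restriction to [C]. *)
apply: le_trans (rk_im_fin_gen (f \o incl C)%FUN (fin_gen_full_sub Cfg)
  (fin_gen_restr A'C A'fg)).
apply: rkS => y /mem_submod_im[x xA' <-]; apply/mem_submod_im.
by exists (exist _ x (A'C x xA')).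
Qed.

(** * Additivity in a finitely generated ambient module *)

(** The composite M -> N -> N/f(A) has kernel [A]. Computing dim(M) through it, and through [f]
    followed by the quotient axiom in N, leaves the finite term dim(N/f(A)) to cancel. *)
Lemma rk_ker_im M N (f : {linear M -> N}) (A : submodClosed M) :
  fin_gen (full M) -> (forall y, exists x, f x = y) ->
  {subset submod_ker f <= A} ->
  d A = d (submod_ker f) + d (submod_im f A).
Proof.
move=> Mfg fs kA; pose p := (proj (submod_im f A) \o f)%FUN.
have ps v : exists x, p x = v.
  by have [y <-] := proj_surj v; have [x <-] := fs y; exists x.
have kp : submod_ker p =i A.
  move=> x; rewrite in_submod_ker /p /= -(linear0 (proj (submod_im f A))) proj_eq.
  rewrite subr0; apply/idP/idP => [/mem_submod_im[a aA fa]|]; last first.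
    exact: mem_submod_im_apply.
  rewrite -(subrK a x) rpredD //; apply: kA.
  by rewrite in_submod_ker linearB fa subrr.
have fQ := rk_quot_fin (full (quot (submod_im f A))) (fin_gen_full_surj fs Mfg).
have := rk_surj ps.
rewrite (rk_ext kp) (rk_surj fs) (rk_quot dim (submod_im f A)) => E.
by rewrite -(addeK (d A) fQ) -E addeA addeK.
Qed.

Lemma proj_ker M (A : submodClosed M) : submod_ker (proj A) =i A.
Proof.
by move=> x; rewrite in_submod_ker -(linear0 (proj A)) proj_eq subr0.
Qed.

(** This is the desired formula for finitely generated M, namely [rk_ker_im] for the projection M ->
    M/A. *)
Lemma rk_proj M (A B : submodClosed M) : fin_gen (full M) -> {subset A <= B} ->
  d B = d A + d (submod_im (proj A) B).
Proof.
move=> Mfg AB; rewrite -(rk_ext (proj_ker A)); apply: rk_ker_im => //.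
  exact: proj_surj.
by move=> x; rewrite proj_ker; apply: AB.
Qed.

(** * The two inequalities in an arbitrary ambient module *)

(** The rank of G is measured in M, but that of F modulo G only in X/G. A finitely generated [C]
    approximates M around i(G), and [rk_proj] is applied in T = C + i(X), which receives both [C]
    and X. *)
Lemma rk_im_le_proj M (X : lmodType R) (i : {linear X -> M}) (G F : submodClosed X) :
  fin_gen (full X) -> fin_gen G ->
  d (submod_im i F) <= d (submod_im i G) + d (submod_im (proj G) F).
Proof.
move=> Xfg Gfg; apply: rk_ge_lb.
- exact: rk_quot_fin.
- exact: fin_gen_im.
move=> C Cfg GC; pose T := submod_add C (submod_im i (full X)).
have Tfg : fin_gen T by apply: fin_gen_add => //; apply: fin_gen_im.
have [x|j jE] := @corestr_ex _ _ _ i T.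
  by apply: submod_addr; apply: mem_submod_im_apply.
have [x|c cE] := @corestr_ex _ _ _ (incl C) T.
  by apply: submod_addl; apply: (valP x).
have [x xG|r rE] := @quot_lift_ex _ _ _ (proj (submod_im j G) \o j)%FUN G.
  by rewrite in_submod_ker /= -in_submod_ker proj_ker mem_submod_im_apply.
apply: (@le_trans _ _ (d (submod_im j F))).
  apply: le_trans (rk_im_le (incl T) _); apply: rkS => _ /mem_submod_im[x xF <-].
  by rewrite -jE; apply: (mem_submod_im_apply (incl T)); apply: mem_submod_im_apply.
apply: (@le_trans _ _ (d (submod_add (submod_im j G) (submod_im j F)))).
  exact/rkS/submod_addr.
rewrite (rk_proj (fin_gen_full_sub Tfg) (submod_addl (submod_im j F))).
(* The two terms are bounded through the inclusion C -> T and the induced map [r] : X/G ->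
   T/j(G). *)
apply: leeD.
  apply: le_trans (rk_im_le c _); apply: rkS => _ /mem_submod_im[x xG <-].
  have ixC : i x \in C by apply: GC; apply: mem_submod_im_apply.
  apply/mem_submod_im; exists (exist _ (i x) ixC).
    by rewrite in_restr; apply: mem_submod_im_apply.
  by apply: val_inj; rewrite cE jE.
apply: le_trans (rk_im_le r _); apply: rkS => _ /mem_submod_im[y + <-].
move=> /in_add[u [v [uG /mem_submod_im[x xF <-] ->]]].
apply/mem_submod_im; exists (proj G x); first exact: mem_submod_im_apply.
rewrite rE /= linearD -[LHS]add0r; congr (_ + _)%R.
by apply/esym/eqP; rewrite -in_submod_ker proj_ker.
Qed.

Lemma rk_le_ker_im M N (h : {linear M -> N}) (F : submodClosed M) :
  (forall y, exists x, h x = y) -> fin_gen F ->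
  d F <= d (submod_ker h) + d (submod_im h F).
Proof.
move=> hs Ffg.
have [kfin|] := boolP (d (submod_ker h) \is a fin_num); last first.
  rewrite ge0_fin_numE ?rk_ge0 // -leNgt leye_eq => /eqP->.
  by rewrite addye ?leey // gt_eqF // (lt_le_trans _ (rk_ge0 _ _)) // ltNy0.
rewrite addeC; apply: rk_ge_lb => //; first exact: fin_gen_im.
move=> B' B'fg FB'.
have [|B0 [B0fg _ hB0]] := @fin_gen_lift _ _ _ h (full M) B' B'fg.
  by move=> y _; have [x <-] := hs y; apply: mem_submod_im_apply.
(* Adding [F] keeps h(B) = B', since h(F) lies in [B']; thus [h] restricts to a surjection [k] : B
   -> B'. *)
pose B := submod_add B0 F.
have Bfg : fin_gen B by apply: fin_gen_add.
have Xfg := fin_gen_full_sub Bfg.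
have FB : {subset F <= B} := submod_addr B0 (B := F).
have [x|k kE] := @corestr_ex _ _ _ (h \o incl B)%FUN B'.
  have /in_add[u [v [uB vF /= ->]]] := valP x.
  rewrite linearD rpredD //; first by rewrite -hB0; apply: mem_submod_im_apply.
  by apply: FB'; apply: mem_submod_im_apply.
have ks y : exists x, k x = y.
  have := valP y; rewrite -hB0 => /mem_submod_im[x xB0 hx].
  by exists (exist _ x (submod_addl F xB0)); apply: val_inj; rewrite kE.
pose F' := restr_submod B F; pose S := submod_add (submod_ker k) F'.
have imF' : submod_im (incl B) F' =i F by apply: im_incl.
(* The kernel of [k] need not be finitely generated, so the bound is proved for finitely generated G
   inside it. The sum dim(G) + dim(S/G) = dim(S) is independent of G, which lets the supremum be
   taken. *)
have kG : d (submod_ker k) + d F <= d (submod_ker h) + d S.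
  apply: rk_le_ub; first exact: rk_fin_gen_fin.
  move=> G Gfg Gk.
  have GS : {subset G <= S} by move=> x /Gk; apply: submod_addl.
  rewrite (rk_proj Xfg GS) addeCA leeD2l //.
  rewrite -(rk_ext imF'); apply: le_trans (rk_im_le_proj _ _ Xfg Gfg) _.
  apply: leeD; last by apply/rkS/submod_imS/submod_addr.
  apply: rkS => _ /mem_submod_im[x /Gk + <-].
  rewrite !in_submod_ker => /eqP kx.
  by rewrite -[X in X == _]/((h \o incl B)%FUN x) -kE kx.
(* Since k(S) lies in h(F), [rk_ker_im] bounds dim(S) by dim(ker k) + dim(h F | B'), and the finite
   dim(ker k) cancels. *)
rewrite -(@leeD2lE _ (d (submod_ker k))) ?rk_fin //.
apply: le_trans kG _.
rewrite addeC addeA leeD2r // (rk_ker_im Xfg ks (submod_addl (F'))) leeD2l //.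
apply: rkS => _ /mem_submod_im[x + <-] => /in_add[u [v [uk vF ->]]].
rewrite linearD in_restr.
rewrite in_submod_ker in uk; rewrite (eqP uk) add0r kE.
by apply: (mem_submod_im_apply h).
Qed.

(** Inside a finitely generated [C] containing G + F, [rk_proj] splits the rank along G. Passing
    from [C] to M lowers the rank of G, and [h] induces a map C/G -> N that carries the other part
    onto a submodule containing h(F). *)
Lemma rk_ker_im_le M N (h : {linear M -> N}) (G F : submodClosed M) :
  {subset G <= submod_ker h} -> fin_gen G -> fin_gen F ->
  d G + d (submod_im h F) <= d (submod_add G F).
Proof.
move=> Gh Gfg Ffg; rewrite -[leRHS]adde0; apply: rk_ge_lb => //.
  exact: fin_gen_add.
move=> C Cfg GFC; rewrite adde0.
have GC : {subset G <= C} by move=> x xG; apply/GFC/submod_addl.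
have [x xG|r rE] := @quot_lift_ex _ _ _ (h \o incl C)%FUN (restr_submod C G).
  by have := Gh _ xG; rewrite !in_submod_ker.
rewrite (@rk_proj _ (restr_submod C G)); first last.
- by move=> x; rewrite !in_restr; apply: submod_addl.
- exact: fin_gen_full_sub.
apply: leeD; first exact: rk_restr.
apply: le_trans (rk_im_le r _); apply: rkS => _ /mem_submod_im[x xF <-].
have xGF : x \in submod_add G F by apply: submod_addr.
pose x' : submod_type C := exist _ x (GFC x xGF).
apply/mem_submod_im; exists (proj _ x'); last by rewrite rE.
exact: mem_submod_im_apply.
Qed.

End Rank.

Theorem theorem3p4 (R : pzRingType) (K : realType) (dim : bivariant_rank R K)
  (M3 : lmodType R) (M1 M2 : submodClosed M3) :
  {subset M1 <= M2} ->
  dim M3 M2 = (dim M3 M1 + dim (quot M1) (quot_submod M1 M2))%E.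
Proof.
move=> M12; apply/eqP; rewrite eq_le; apply/andP; split.
  rewrite -[leLHS]adde0; apply: rk_le_ub => // F Ffg FM2; rewrite adde0.
  apply: le_trans (rk_le_ker_im dim (@proj_surj _ _ M1) Ffg) _.
  by rewrite (rk_ext _ (proj_ker M1)) leeD2l // rkS //; apply: submod_imS.
(* If dim(M1 | M3) is infinite, monotonicity makes the left side infinite too; otherwise [rk_le_ub]
   may treat it as the finite summand. *)
have [fin1|] := boolP (dim M3 M1 \is a fin_num); last first.
  rewrite ge0_fin_numE ?rk_ge0 // -leNgt leye_eq => /eqP oo1.
  by have := rkS dim M12; rewrite oo1 leye_eq => /eqP->; apply: leey.
rewrite addeC; apply: rk_le_ub => // B Bfg BM2.
have [F [Ffg FM2 hF]] := fin_gen_lift Bfg BM2.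
(* With [B] written as the image of [F], its rank is finite, and the supremum over finitely
   generated submodules of [M1] can be taken next. *)
rewrite -(rk_ext dim hF) addeC; apply: rk_le_ub.
  by apply/rk_fin_gen_fin/fin_gen_im.
move=> G Gfg GM1; apply: (@le_trans _ _ (rk dim (submod_add G F))).
  by apply: rk_ker_im_le => // x /GM1; rewrite proj_ker.
by apply/rkS/submod_add_sub => // x /GM1/M12.
Qed.
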